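(* If $\lambda$ is a (strongly) inaccessible cardinal and $2^\lambda=\lambda^+$, then there is a nowhere trivial automorphism of the Boolean algebra $\mathcal P(\lambda)/[\lambda]^{<\lambda}$.
   Context: For $A\subseteq\lambda$, $[A]^{<\lambda}$ is the set of subsets of $A$ of cardinality less than $\lambda$, and $[A]^{\lambda}$ the set of subsets of $A$ of cardinality $\lambda$. For $A\subseteq\lambda$, $[A]$ denotes the equivalence class of $A$ modulo the ideal $[\lambda]^{<\lambda}$. $\mathrm{Sym}(\lambda)$ is the set of bijections $f:\lambda\to\lambda$, and $f[B]:=\{f(b):b\in B\}$ is the pointwise image. A Boolean algebra automorphism $\pi$ of $\mathcal P(\lambda)/[\lambda]^{<\lambda}$ is called trivial on $A$ (for $A\in[\lambda]^\lambda$) if there is an $f\in\mathrm{Sym}(\lambda)$ such that $\pi([B])=[f[B]]$ for all $B\subseteq A$. $\pi$ is called nowhere trivial if there is no such pair $(f,A)$, i.e., if there is no $A\in[\lambda]^\lambda$ such that $\pi$ is trivial on $A$. *)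

(* Defs.v *)
From HB Require Import structures.
From mathcomp Require Import all_boot all_order.
From mathcomp Require Import boolp classical_sets functions cardinality.

Set Implicit Arguments.
Unset Strict Implicit.
Unset Printing Implicit Defensive.

Local Open Scope classical_set_scope.
Local Open Scope card_scope.

(* A cardinal is represented by a type T of that cardinality: |A| = lambda is
   A #= [set: T], and 2 ^ lambda is the cardinality of [set: set T]. *)

Definition card_lt T U (A : set T) (B : set U) : Prop :=
  A #<= B /\ ~ (B #<= A).

Definition succ_card (T U : Type) : Prop :=
  card_lt [set: T] [set: U] /\
  forall V : Type, card_lt [set: T] [set: V] -> [set: U] #<= [set: V].

Definition regular_card (T : Type) : Prop :=
  infinite_set [set: T] /\
  forall F : set (set T), card_lt F [set: T] ->
    (forall A, F A -> card_lt A [set: T]) ->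
    card_lt (\bigcup_(A in F) A) [set: T].

Definition strong_limit_card (T : Type) : Prop :=
  forall A : set T, card_lt A [set: T] ->
    card_lt [set B : set T | B `<=` A] [set: T].

Record inaccessible (T : Type) : Prop := Inaccessible {
  inaccessible_uncountable : ~ countable [set: T];
  inaccessible_regular : regular_card T;
  inaccessible_strong_limit : strong_limit_card T
}.

Definition small T (A : set T) : Prop := card_lt A [set: T].

Lemma sub_small T (A B : set T) : A `<=` B -> small B -> small A.
Proof.
move=> AB [_ nB]; split; first exact: card_leT.
by move=> TA; apply: nB; apply: card_le_trans TA (subset_card_le AB).
Qed.

Section Quotient.
Variables (T : Type) (regT : regular_card T).
Implicit Types A B C : set T.

Lemma finite_card_lt U (F : set U) : finite_set F -> card_lt F [set: T].
Proof.
move=> finF; split.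
  apply: card_le_trans (finite_set_countable finF) _.
  by apply/infiniteP; case: regT.
by move=> TF; case: regT => + _; apply; apply: card_le_finite TF finF.
Qed.

Lemma small0 : small (@set0 T).
Proof. exact/finite_card_lt/finite_set0. Qed.

Lemma smallU A B : small A -> small B -> small (A `|` B).
Proof.
move=> sA sB; have [_ /(_ [set A; B])] := regT.
rewrite bigcup_setU !bigcup_set1; apply; first exact/finite_card_lt/finite_set2.
by move=> C [] ->.
Qed.

(* A `+` B is the symmetric difference. *)
Definition eq_mod_small : rel (set T) := fun A B => `[< small (A `+` B) >].

Lemma eq_mod_small_refl : reflexive eq_mod_small.
Proof. by move=> A; apply/asboolP; rewrite setYK; exact: small0. Qed.

Lemma eq_mod_small_sym : symmetric eq_mod_small.
Proof. by move=> A B; rewrite /eq_mod_small setYC. Qed.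

Lemma eq_mod_small_trans : transitive eq_mod_small.
Proof.
move=> B A C /asboolP AB /asboolP BC; apply/asboolP.
apply: sub_small (smallU AB BC) => x [[Ax nCx]|[Cx nAx]];
  have [Bx|nBx] := pselect (B x); by [left; left|left; right|right; left|right; right].
Qed.

Canonical eq_mod_small_equiv := EquivRel eq_mod_small
  eq_mod_small_refl eq_mod_small_sym eq_mod_small_trans.

Local Open Scope quotient_scope.

Definition Pmod := {eq_quot eq_mod_small}.

HB.instance Definition _ := Choice.on Pmod.
HB.instance Definition _ := EqQuotient.on Pmod.

Definition class_of A : Pmod := \pi_Pmod A.

Lemma class_ofP A B : class_of A = class_of B <-> small (A `+` B).
Proof. by split=> [/eqmodP/asboolP|AB]; last exact/eqmodP/asboolP. Qed.

Definition meet_mod (X Y : Pmod) := class_of (repr X `&` repr Y).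
Definition join_mod (X Y : Pmod) := class_of (repr X `|` repr Y).
Definition compl_mod (X : Pmod) := class_of (~` repr X).

Lemma repr_class A : small (repr (class_of A) `+` A).
Proof. by apply/class_ofP; rewrite /class_of reprK. Qed.

Lemma class_ofI A B : class_of (A `&` B) = meet_mod (class_of A) (class_of B).
Proof.
apply/esym/class_ofP; apply: sub_small (smallU (repr_class A) (repr_class B)).
move: (repr _) (repr _) => A' B' x.
rewrite /setY /setD /setU /setI /=.
by have [] := pselect (A x); have [] := pselect (A' x);
  have [] := pselect (B x); have [] := pselect (B' x); tauto.
Qed.

Lemma class_ofU A B : class_of (A `|` B) = join_mod (class_of A) (class_of B).
Proof.
apply/esym/class_ofP; apply: sub_small (smallU (repr_class A) (repr_class B)).
move: (repr _) (repr _) => A' B' x.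
rewrite /setY /setD /setU /setI /=.
by have [] := pselect (A x); have [] := pselect (A' x);
  have [] := pselect (B x); have [] := pselect (B' x); tauto.
Qed.

Lemma class_ofC A : class_of (~` A) = compl_mod (class_of A).
Proof.
apply/esym/class_ofP; apply: sub_small (repr_class A).
move: (repr _) => A' x; rewrite /setY /setD /setU /setC /=.
by have [] := pselect (A x); have [] := pselect (A' x); tauto.
Qed.

Lemma class_ofW (P : Pmod -> Prop) : (forall A, P (class_of A)) -> forall X, P X.
Proof. by move=> PA X; rewrite -[X]reprK; exact: PA. Qed.

Let le_mod (X Y : Pmod) := meet_mod X Y == X.
Let lt_mod (X Y : Pmod) := (Y != X) && le_mod X Y.

Let meetC : commutative meet_mod.
Proof. by elim/class_ofW=> A; elim/class_ofW=> B; rewrite -!class_ofI setIC. Qed.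

Let joinC : commutative join_mod.
Proof. by elim/class_ofW=> A; elim/class_ofW=> B; rewrite -!class_ofU setUC. Qed.

Let meetA : associative meet_mod.
Proof.
by elim/class_ofW=> A; elim/class_ofW=> B; elim/class_ofW=> C;
  rewrite -!class_ofI setIA.
Qed.

Let joinA : associative join_mod.
Proof.
by elim/class_ofW=> A; elim/class_ofW=> B; elim/class_ofW=> C;
  rewrite -!class_ofU setUA.
Qed.

Let joinKI Y X : meet_mod X (join_mod X Y) = X.
Proof.
by elim/class_ofW: X => A; elim/class_ofW: Y => B;
  rewrite -class_ofU -class_ofI setUC setKU.
Qed.

Let meetKU Y X : join_mod X (meet_mod X Y) = X.
Proof.
by elim/class_ofW: X => A; elim/class_ofW: Y => B;
  rewrite -class_ofI -class_ofU setIC setKI.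
Qed.

Let meetUl : left_distributive meet_mod join_mod.
Proof.
by elim/class_ofW=> A; elim/class_ofW=> B; elim/class_ofW=> C;
  rewrite -class_ofU -!class_ofI -class_ofU setIUl.
Qed.

Let meetxx : idempotent_op meet_mod.
Proof. by elim/class_ofW=> A; rewrite -class_ofI setIid. Qed.

Fact Pmod_display : Order.disp_t. Proof. exact: Order.Disp tt tt. Qed.

HB.instance Definition _ := Order.isMeetJoinDistrLattice.Build
  Pmod_display Pmod (fun X Y => erefl (le_mod X Y))
  (fun X Y => erefl (lt_mod X Y)) meetC joinC meetA joinA joinKI meetKU
  meetUl meetxx.

Let le0x (X : Pmod) : (class_of set0 <= X)%O.
Proof. by elim/class_ofW: X => A; apply/eqP; rewrite -class_ofI set0I. Qed.

Let lex1 (X : Pmod) : (X <= class_of setT)%O.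
Proof. by elim/class_ofW: X => A; apply/eqP; rewrite -class_ofI setIT. Qed.

HB.instance Definition _ := Order.hasBottom.Build Pmod_display Pmod le0x.
HB.instance Definition _ := Order.hasTop.Build Pmod_display Pmod lex1.

Let joinxC (X : Pmod) : (X `|` compl_mod X = \top)%O.
Proof.
by elim/class_ofW: X => A; rewrite -class_ofC -[LHS]class_ofU setUv.
Qed.

Let meetxC (X : Pmod) : (X `&` compl_mod X = \bot)%O.
Proof.
by elim/class_ofW: X => A; rewrite -class_ofC -[LHS]class_ofI setICr.
Qed.

HB.instance Definition _ := Order.TBDistrLattice_hasComplement.Build
  Pmod_display Pmod joinxC meetxC.

Definition trivial_on (pi : Pmod -> Pmod) A : Prop :=
  exists f : T -> T, bijective f /\
    forall B, B `<=` A -> pi (class_of B) = class_of (f @` B).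

Definition nowhere_trivial (pi : Pmod -> Pmod) : Prop :=
  forall A, A #= [set: T] -> ~ trivial_on pi A.

End Quotient.

Definition boolean_automorphism d (L : ctbDistrLatticeType d) (pi : L -> L)
    : Prop :=
  [/\ bijective pi,
      {morph pi : x y / (x `&` y)%O} /\ {morph pi : x y / (x `|` y)%O},
      {morph pi : x / (~` x)%O},
      pi \bot%O = \bot%O
    & pi \top%O = \top%O].

(* Main.v *)
Require Import Defs.
From mathcomp Require Import all_boot all_order.
From mathcomp Require Import boolp classical_sets functions cardinality.
From mathcomp Require Import wochoice.

(** Write lambda for the cardinal of [T], well-ordered so that initial segments
    are small.  The automorphism is the limit of a tower of lambda^+
    permutations [g_a] of lambda, indexed by the subsets [a] of lambda in a
    well-order all of whose initial segments have at most lambda elements; this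
    is where [2 ^ lambda = lambda^+] enters.  Stage [a] promises that a few sets
    [Z], among them [a] and [g_a^-1 [a]], keep their image for good:
    [g_c [Z] = g_a [Z]] modulo small sets for all later [c].  Then
    [[a] |-> [g_c [a]]], for [c] late enough, is a well-defined automorphism:
    finitely many sets can be handled by one common permutation [g_c], and the
    promise about [g_a^-1 [a]] gives surjectivity.  Stage [a] also decodes from
    [a] a pair [(A, f)] and, if [A] has size lambda, makes [g_a [B]] differ from
    [f [B]] modulo small sets for some [B] included in [A], whose image it
    promises to keep; so the limit is nowhere trivial.

    To disagree with [f] on [A], one swaps lambda many disjoint pairs of points
    of [A], the [t]-th pair being indistinguishable by the sets promised at the
    first [t] earlier stages.  Such pairs exist by the pigeonhole principle,
    because lambda is a regular strong limit
    ([indistinguishable_pairs], [disagreeing_extension]).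

    The difficulty is to continue at limit stages: the algebra
    [P(lambda)/[lambda]^{<lambda}] is not countably saturated, and the images of a
    point moved infinitely often need not converge.  Every stage therefore
    carries a rank function [r : lambda -> lambda] whose sublevel sets are small,
    and a point may change its image only if its rank strictly drops
    ([refines_at]).  As ranks are well-founded, the images of a point under the stages active at it are
    eventually constant ([limit_ranked_perm]); as sublevel sets are small, every
    set of size lambda still has lambda many points of large rank, so that there
    is always room for the next swap.  The condition is symmetric between a
    permutation and its inverse, so the pointwise limit is onto.  At most lambda
    stages precede a given one, and the conditions relating two of them fail on a
    small set only.  So the limit can be taken by diagonalisation: each earlier
    stage is active at all but a small set of points, and all conditions hold
    between the stages active at a given point.  This treats successor stages
    and limit stages of every cofinality alike. *)

Set Implicit Arguments.
Unset Strict Implicit.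
Unset Printing Implicit Defensive.

Local Open Scope classical_set_scope.
Local Open Scope card_scope.

(** * Comparing cardinals *)

Lemma injection_card_le T U (A : set T) (B : set U) (f : T -> U) :
  (forall x, A x -> B (f x)) ->
  (forall x y, A x -> A y -> f x = f y -> x = y) -> A #<= B.
Proof.
move=> fAB finj; have [F] : $|{injfun A >-> B}|.
  by apply/injfunPex; exists f => // x y /set_mem Ax /set_mem Ay; exact: finj.
exact: inj_card_le F.
Qed.

Lemma card_le_injection T U (u0 : U) (A : set T) (B : set U) : A #<= B ->
  exists f : T -> U, (forall x, A x -> B (f x)) /\
    forall x y, A x -> A y -> f x = f y -> x = y.
Proof.
elim/Ppointed: U => U in u0 B *; first by have := no u0.
move=> /pcard_leP/injfunPex[f fAB finj]; exists f; split=> // x y Ax Ay.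
by apply: finj; apply: mem_set.
Qed.

(** Zorn's lemma on the graphs of partial injections from [A] to [B]: a maximal
    one is total on one of the two sides. *)
Lemma card_le_total T U (A : set T) (B : set U) : A #<= B \/ B #<= A.
Proof.
pose P (G : set (T * U)) := [/\ forall p, G p -> A p.1 /\ B p.2,
  forall p q, G p -> G q -> p.1 = q.1 -> p = q &
  forall p q, G p -> G q -> p.2 = q.2 -> p = q].
have [|G [[GAB G1 G2] Gmax]] := @Zorn_bigcup _ P.
  move=> F FP Ftot.
  have Fpair p q : (\bigcup_(X in F) X) p -> (\bigcup_(X in F) X) q ->
      exists X, [/\ P X, X p & X q].
    move=> [X FX Xp] [Y FY Yq].
    have [XY|YX] := Ftot _ _ FX FY.
      by exists Y; split=> //; [exact: FP|exact: XY].
    by exists X; split=> //; [exact: FP|exact: YX].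
  split=> [p [X /FP[+ _ _]]|p q Fp Fq|p q Fp Fq]; first exact.
    by have [X [[_ + _] Xp Xq]] := Fpair _ _ Fp Fq; exact.
  by have [X [[_ _ +] Xp Xq]] := Fpair _ _ Fp Fq; exact.
have [Afull|/existsNP[a /not_implyP[Aa nGa]]] :=
    pselect (forall a, A a -> exists b, G (a, b)).
  left; have [->//|/set0P[a0 Aa0]] := eqVneq A set0.
  have [b0 _] := Afull _ Aa0.
  have /choice[f fP] a : exists b, A a -> G (a, b).
    have [Aa|nAa] := pselect (A a); last by exists b0.
    by have [b] := Afull _ Aa; exists b.
  apply: (injection_card_le (f := f)) => [x /fP/GAB[]//|x y /fP Gx /fP Gy fxy].
  by have [] := G2 _ _ Gx Gy fxy.
have [Bfull|/existsNP[b /not_implyP[Bb nGb]]] :=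
    pselect (forall b, B b -> exists a, G (a, b)).
  right; have /choice[f fP] b : exists a', B b -> G (a', b).
    have [Bb|nBb] := pselect (B b); last by exists a.
    by have [a'] := Bfull _ Bb; exists a'.
  apply: (injection_card_le (f := f)) => [x /fP/GAB[]//|x y /fP Gx /fP Gy fxy].
  by have [] := G1 _ _ Gx Gy fxy.
exfalso; apply: (Gmax (G `|` [set (a, b)])).
  split=> [p|ab]; first by left.
  by apply: nGa; exists b; apply: ab; right.
split=> [p [/GAB//|->//]|p q|p q].
  move=> [Gp|->] [Gq|->] //=; first exact: G1.
    by move=> pa; exfalso; apply: nGa; exists p.2; rewrite -pa -surjective_pairing.
  by move=> pa; exfalso; apply: nGa; exists q.2; rewrite pa -surjective_pairing.
move=> [Gp|->] [Gq|->] //=; first exact: G2.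
  by move=> pa; exfalso; apply: nGb; exists p.1; rewrite -pa -surjective_pairing.
by move=> pa; exfalso; apply: nGb; exists q.1; rewrite pa -surjective_pairing.
Qed.

Lemma card_le_lt_trans T U V (A : set T) (B : set U) (C : set V) :
  A #<= B -> card_lt B C -> card_lt A C.
Proof.
move=> AB [BC nCB]; split; first exact: card_le_trans AB BC.
by move=> CA; apply: nCB; exact: card_le_trans CA AB.
Qed.

(** * Well-orders *)

Definition strict_well_order T (lt : T -> T -> Prop) :=
  [/\ well_founded lt, forall x y z, lt x y -> lt y z -> lt x z &
      forall x y, [\/ lt x y, x = y | lt y x]].

Lemma strict_well_order_min T (lt : T -> T -> Prop) (P : T -> Prop) :
  well_founded lt -> (exists x, P x) ->
  exists x, P x /\ forall y, P y -> ~ lt y x.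
Proof.
move=> wf [x Px]; apply: contrapT => nmin.
elim/(well_founded_ind wf): x Px => x IH Px.
by apply: nmin; exists x; split=> // y Py /IH/(_ Py).
Qed.

Lemma strict_well_order_exists (T : Type) :
  exists lt : T -> T -> Prop, strict_well_order lt.
Proof.
elim/Peq: T => T; have [R Rwo] := well_ordering_principle T.
have Rmin (P : T -> Prop) : (exists x, P x) ->
    exists x, P x /\ forall y, P y -> R x y.
  move=> [x Px]; have [|z [[zP zmin] _]] := Rwo [pred x | `[< P x >]].
    by exists x; apply/asboolP.
  by exists z; split=> [|y Py]; [move/asboolP: zP|apply: zmin; apply/asboolP].
have Rch : wo_chain R predT by move=> A _; exact: Rwo.
have Rtot x y : R x y \/ R y x by apply/orP; exact: (wo_chainW Rch).
have Ranti x y : R x y -> R y x -> x = y.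
  by move=> xy yx; apply: (wo_chain_antisymmetric Rch) => //; rewrite xy yx.
exists (fun x y => R x y /\ x <> y); split.
- move=> x; apply: contrapT => nx.
  have [|z [nz zmin]] := Rmin (fun x => ~ Acc (fun x y => R x y /\ x <> y) x).
    by exists x.
  apply: nz; constructor=> y [Ryz nyz]; apply: contrapT => ny.
  by apply: nyz; apply: Ranti => //; exact: zmin.
- move=> x y z [xy nxy] [yz nyz].
  have [|t [tE tmin]] := Rmin (fun t => [\/ t = x, t = y | t = z]).
    by exists x; apply: Or31.
  have Rx : R t x by apply: tmin; apply: Or31.
  have Ry : R t y by apply: tmin; apply: Or32.
  have Rz : R t z by apply: tmin; apply: Or33.
  case: tE => tE; subst t.
  + split=> // xz; apply: nxy; apply: Ranti => //; by rewrite xz.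
  + by case: nxy; apply: Ranti.
  + by case: nyz; apply: Ranti.
- move=> x y; have [->|nxy] := pselect (x = y); first exact: Or32.
  have [xy|yx] := Rtot x y; first exact: Or31.
  by apply: Or33; split=> // yx'; apply: nxy.
Qed.

(** If some initial segment is equinumerous with [T], transport the order of the
    least such segment to [T]. *)
Lemma minimal_well_order (T : Type) :
  exists lt : T -> T -> Prop, strict_well_order lt /\
    forall x, ~ ([set: T] #<= [set y | lt y x]).
Proof.
have [lt wo] := strict_well_order_exists T.
have [[x Tx]|nT] := pselect (exists x, [set: T] #<= [set y | lt y x]); last first.
  by exists lt; split=> // x Tx; apply: nT; exists x.
have [wf tr tot] := wo.
have [|{Tx} {}x [Tx xmin]] := strict_well_order_min wf (P := fun x =>
    [set: T] #<= [set y | lt y x]); first by exists x.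
have [f [fx finj]] := card_le_injection x Tx.
exists (fun s t => lt (f s) (f t)); split; first split.
- move=> t; move Ey: (f t) => y; elim/(well_founded_ind wf): y t Ey => y IH t ty.
  by constructor=> s; rewrite ty => sy; exact: IH sy _ erefl.
- by move=> r s t; exact: tr.
- move=> s t; case: (tot (f s) (f t)) => [||]; [exact: Or31| |exact: Or33].
  by move=> /finj st; apply: Or32; exact: st.
- move=> t Tt; apply: (xmin (f t)); last exact: fx.
  apply: card_le_trans Tt _; apply: (injection_card_le (f := f)) => // r s _ _.
  exact: finj.
Qed.

(** Recursive construction of a sequence whose terms are pairwise related; the
    extension step may assume this of the terms built so far. *)
Lemma well_founded_choice I V (lt : I -> I -> Prop) (v0 : V)
    (Q : I -> V -> Prop) (ok : V -> V -> Prop) :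
  well_founded lt ->
  (forall i h, (forall j, lt j i -> Q j (h j) /\
                  forall k, lt k j -> ok (h k) (h j)) ->
     exists v, Q i v /\ forall j, lt j i -> ok (h j) v) ->
  exists h, forall i, Q i (h i) /\ forall j, lt j i -> ok (h j) (h i).
Proof.
elim/Pchoice: V => V in v0 Q ok *; move=> wf step.
pose F i (rec : forall j, lt j i -> V) : V :=
  xget v0 [set v | Q i v /\ forall j (ji : lt j i), ok (rec j ji) v].
pose h := Fix wf (fun=> V) F.
have hE i : h i = xget v0 [set v | Q i v /\ forall j, lt j i -> ok (h j) v].
  rewrite /h Fix_eq // => {}i f g fg; congr F.
  by do 2!apply: boolp.functional_extensionality_dep => ?.
exists h => i; elim/(well_founded_ind wf): i => i IH.
by rewrite hE; exact: (xgetPex v0 (step i h IH)).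
Qed.

(** * Small sets *)

Section SmallSets.
Variables (T : Type) (inaccT : inaccessible T).

Let regT := inaccessible_regular inaccT.

Lemma not_smallT : ~ small [set: T].
Proof. by case=> _; apply; exact: card_lexx. Qed.

Lemma small_set1 (x : T) : small [set x].
Proof. exact: (finite_card_lt regT (finite_set1 x)). Qed.

Lemma small_image (f : T -> T) A : small A -> small (f @` A).
Proof. exact/card_le_lt_trans/card_image_le. Qed.

Lemma small_preimage (f : T -> T) A : injective f -> small A -> small (f @^-1` A).
Proof.
move=> finj; apply: card_le_lt_trans.
by apply: (injection_card_le (f := f)) => // x y _ _; exact: finj.
Qed.

Lemma small_bigcup I (J : set I) (F : I -> set T) : card_lt J [set: T] ->
  (forall j, J j -> small (F j)) -> small (\bigcup_(j in J) F j).
Proof.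
move=> sJ sF; have [_ /(_ (F @` J))] := regT.
rewrite bigcup_image; apply; last by move=> _ [j Jj <-]; exact: sF.
exact: card_le_lt_trans (card_image_le _ _) sJ.
Qed.

Lemma countable_card_lt I (J : set I) : countable J -> card_lt J [set: T].
Proof.
move=> cJ; split.
  by apply: card_le_trans cJ _; apply/infiniteP; case: regT.
by move=> TJ; apply: (inaccessible_uncountable inaccT); exact: card_le_trans TJ cJ.
Qed.

Lemma not_small_diff (A N : set T) : ~ small A -> small N -> ~ small (A `\` N).
Proof.
move=> nA sN sAN; apply: nA; apply: sub_small (smallU regT sAN sN) => x Ax.
by have [Nx|nNx] := pselect (N x); [right|left].
Qed.

Lemma not_small_ex (A : set T) : ~ small A -> exists x, A x.
Proof.
move=> nA; apply: contrapT => nx; apply: nA; apply: sub_small (small0 regT).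
by move=> x Ax; apply: nx; exists x.
Qed.

Lemma not_small_ex2 (A : set T) : ~ small A -> exists x y, [/\ A x, A y & x <> y].
Proof.
move=> nA; have [x Ax] := not_small_ex nA.
have [y [Ay nyx]] := not_small_ex (not_small_diff nA (small_set1 x)).
by exists x, y; split=> // xy; apply: nyx.
Qed.

Lemma inhabitant : T.
Proof. by have [x _] := cid (not_small_ex not_smallT). Qed.

Lemma not_small_injective (f : T -> T) (A : set T) : ~ small A ->
  (forall x y, A x -> A y -> f x = f y -> x = y) -> ~ small (f @` A).
Proof.
move=> nA finj sfA; apply: nA; apply: card_le_lt_trans sfA.
by apply: (injection_card_le (f := f)) => // x Ax; exists x.
Qed.

(** The fibres of a map into the subsets of [D] are fewer than lambda by strong
    limitness, so that they cannot all be small by regularity. *)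
Lemma pigeonhole (D : set T) (chi : T -> set T) (A : set T) :
  small D -> (forall x, chi x `<=` D) -> ~ small A ->
  exists A', [/\ A' `<=` A, ~ small A' & forall x y, A' x -> A' y -> chi x = chi y].
Proof.
move=> sD chiD nA; apply: contrapT => nA'; apply: nA.
have sF B : small (A `&` [set x | chi x = B]).
  apply: contrapT => nB; apply: nA'; exists (A `&` [set x | chi x = B]).
  by split=> // x y [_ ->] [_ ->].
apply: sub_small (small_bigcup (inaccessible_strong_limit inaccT sD) (fun B _ => sF B)).
by move=> x Ax; exists (chi x) => //; exact: chiD.
Qed.

(** A point is coded by the set of the colours [c i] that it has. *)
Lemma pigeonhole_colours I (u : set I) (c : I -> set T) (A : set T) :
  card_lt u [set: T] -> ~ small A ->
  exists A', [/\ A' `<=` A, ~ small A' &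
    forall i x y, u i -> A' x -> A' y -> c i x <-> c i y].
Proof.
move=> su nA; have [e [_ einj]] := card_le_injection inhabitant su.1.
pose chi x := [set e i | i in u `&` [set i | c i x]].
have seu : small (e @` u) by apply: card_le_lt_trans (card_image_le _ _) su.
have [|A' [A'A nA' chiE]] := @pigeonhole (e @` u) chi A seu _ nA.
  by move=> x _ [i [ui _] <-]; exists i.
exists A'; split=> // i x y ui A'x A'y.
have chi_c z : c i z <-> chi z (e i).
  by split=> [ciz|[j [uj cjz] /einj ji]]; [exists i|rewrite -ji].
by rewrite (chi_c x) (chi_c y) (chiE x y).
Qed.

Variable lt : T -> T -> Prop.
Hypothesis wo : strict_well_order lt.
Hypothesis seg : forall x, ~ ([set: T] #<= [set y | lt y x]).

Let tr := let: And3 _ tr _ := wo in tr.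
Let tot := let: And3 _ _ tot := wo in tot.
Let wf := let: And3 wf _ _ := wo in wf.

Lemma lt_irr x : ~ lt x x.
Proof. by elim/(well_founded_ind wf): x => x IH xx; apply: (IH x). Qed.

Lemma small_seg x : small [set y | lt y x].
Proof. by split; [exact: card_leT|exact: seg]. Qed.

Lemma small_segle x : small [set y | ~ lt x y].
Proof.
apply: sub_small (smallU regT (small_seg x) (small_set1 x)) => y /= nxy.
by have [//|xy|yx] := tot x y; [right|left].
Qed.

Lemma lt_unbounded x : exists y, lt x y.
Proof.
have [y [_ /contrapT xy]] :=
  not_small_ex (not_small_diff not_smallT (small_segle x)).
by exists y.
Qed.

(** Goedel pairing: the pairs preceding a given one in the order by maximum lie
    in the square of a small set, so their images cannot exhaust the target. *)
Lemma pairing : exists pr : T * T -> T, injective pr.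
Proof.
have [ltp [wfp trp totp]] := strict_well_order_exists (T * T).
pose m (p : T * T) := if pselect (lt p.1 p.2) then p.2 else p.1.
have m1 p : ~ lt (m p) p.1.
  rewrite /m; case: pselect => [p12|n12] /=; last exact: lt_irr.
  by move=> p21; exact: lt_irr (tr p12 p21).
have m2 p : ~ lt (m p) p.2.
  by rewrite /m; case: pselect => //= n12; exact: lt_irr.
pose ltm p q := lt (m p) (m q) \/ m p = m q /\ ltp p q.
have wfm : well_founded ltm.
  move=> p; move Ex: (m p) => x; elim/(well_founded_ind wf): x p Ex => x IHx p.
  elim/(well_founded_ind wfp): p => p IHp px.
  constructor=> q [qp|[qp ltqp]]; first by rewrite px in qp; exact: IHx qp q erefl.
  by apply: (IHp q ltqp); rewrite qp.
have totm p q : [\/ ltm p q, p = q | ltm q p].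
  have [mpq|mpq|mqp] := tot (m p) (m q); first by apply: Or31; left.
    have [pq|->|qp] := totp p q; [|exact: Or32|].
      by apply: Or31; right.
    by apply: Or33; right.
  by apply: Or33; left.
have [|pr prP] := @well_founded_choice _ T ltm inhabitant (fun _ _ => True)
    (fun v w => v <> w) wfm.
  move=> p h _; pose S := [set y | ~ lt (m p) y].
  have sS : small S := small_segle (m p).
  have sH : small (\bigcup_(a in S) ((fun b => h (a, b)) @` S)).
    by apply: small_bigcup => // a _; exact: small_image.
  have [v [_ nv]] := not_small_ex (not_small_diff not_smallT sH).
  exists v; split=> // q qp hqv; apply: nv.
  have le_m t : ~ lt (m q) t -> ~ lt (m p) t.
    case: qp => [qp|[<- _]//] nqt pt; apply: nqt; exact: tr qp pt.
  exists q.1; first exact: le_m (@m1 q).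
  by exists q.2; rewrite -?surjective_pairing //; exact: le_m (@m2 q).
exists pr => p q pq; have [pltq|//|qltp] := totm p q.
  by have [_ /(_ p pltq)] := prP q.
by have [_ /(_ q qltp)] := prP p; rewrite pq.
Qed.

End SmallSets.

(** * Ranked permutations *)

Lemma injective_surjective_bijective A B (f : A -> B) :
  injective f -> (forall y, exists x, f x = y) -> bijective f.
Proof. by move=> finj /choice[g fK]; exists g => // x; exact: finj. Qed.

(** The sets whose image is fixed from some stage of the tower on: the set that
    indexes the stage, its preimage, which makes the limit surjective, and the
    set on which the stage disagrees with its task. *)
Inductive tracked := Source | Target | Witness.

Record ranked_perm (T : Type) := RankedPerm {
  perm : T -> T;
  rank : T -> T;
  track : tracked -> set T
}.

Section RankedPermutations.
Variables (T : Type) (inaccT : inaccessible T).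
Variable lt : T -> T -> Prop.
Hypothesis wo : strict_well_order lt.
Hypothesis seg : forall x, ~ ([set: T] #<= [set y | lt y x]).

Let regT := inaccessible_regular inaccT.
Let tr := let: And3 _ tr _ := wo in tr.
Let tot := let: And3 _ _ tot := wo in tot.
Let wf := let: And3 wf _ _ := wo in wf.

Lemma le_lt x y z : ~ lt y x -> lt y z -> lt x z.
Proof. by move=> nyx yz; have [xy|->//|//] := tot x y; exact: tr xy yz. Qed.

Lemma lt_le x y z : lt x y -> ~ lt z y -> lt x z.
Proof. by move=> xy nzy; have [yz|<-//|//] := tot y z; exact: tr xy yz. Qed.

(** The condition is symmetric under inversion if ranks are attached to the edges
    [(x, g x)] of the graph: a new edge is either an old one, or of smaller rank
    than the two old edges, starting at [x] and at [x'], with which it shares an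
    endpoint.  The last clause makes [g] and [perm p] agree on the tracked sets. *)
Definition refines_at (p : ranked_perm T) (g r : T -> T) x :=
  ~ lt (rank p x) (r x) /\
  forall x', perm p x' = g x -> x' = x \/
    [/\ lt (r x) (rank p x), lt (r x) (rank p x') &
        forall k, track p k x' <-> track p k x].

Definition refines p q := small [set x | ~ refines_at p (perm q) (rank q) x].

Definition tends_to_lambda (r : T -> T) := forall t, small [set x | lt (r x) t].

Definition invariant_hull I (J : set I) (f : I -> T -> T) (B : set T) : set T :=
  [set x | forall C : set T, B `<=` C ->
     (forall j, J j -> forall y, C y <-> C (f j y)) -> C x].

(** Since lambda is uncountable and regular, countably many rounds of adding
    fewer than lambda images and preimages keep the set small. *)
Lemma small_invariant_hull I (J : set I) (f : I -> T -> T) (B : set T) :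
  card_lt J [set: T] -> (forall j, J j -> injective (f j)) -> small B ->
  small (invariant_hull J f B).
Proof.
move=> sJ finj sB.
pose E := fix E n := if n is n.+1 then
  E n `|` \bigcup_(j in J) (f j @` E n `|` f j @^-1` E n) else B.
have sE n : small (E n).
  elim: n => [//|n IH] /=; apply: (smallU regT) => //.
  apply: (small_bigcup inaccT) => // j Jj; apply: (smallU regT).
    exact: small_image.
  by apply: small_preimage => //; exact: finj.
apply: sub_small (small_bigcup inaccT (countable_card_lt inaccT (countableP [set: nat]))
  (fun n _ => sE n)) => x.
apply=> [y By|j Jj y]; first by exists 0.
by split=> -[n _ Eny]; exists n.+1 => //; right; exists j => //;
  [left; exists y|right].
Qed.

Section Limit.
Variables (I : Type) (ltI : I -> I -> Prop).
Hypothesis totI : forall i j, [\/ ltI i j, i = j | ltI j i].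
Variables (U : set I) (e : I -> T).
Hypothesis einj : forall i j, U i -> U j -> e i = e j -> i = j.
Variable p : I -> ranked_perm T.
Hypothesis p_bij : forall i, U i -> bijective (perm (p i)).
Hypothesis p_rank : forall i, U i -> tends_to_lambda (rank (p i)).
Hypothesis p_refines :
  forall i j, U i -> U j -> ltI i j -> refines (p i) (p j).

Let u t := [set i | U i /\ lt (e i) t].

Let card_u t : card_lt (u t) [set: T].
Proof.
apply: card_le_lt_trans (small_seg seg t).
apply: (injection_card_le (f := e)) => [i []//|i j [Ui _] [Uj _]]; exact: einj.
Qed.

Let exceptions i j := [set x | ~ refines_at (p i) (perm (p j)) (rank (p j)) x].

Let base t :=
  (\bigcup_(i in u t) \bigcup_(j in u t `&` [set j | ltI i j]) exceptions i j)
  `|` \bigcup_(i in u t) [set x | lt (rank (p i) x) t].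

(* The points at which the stages in u t are not yet in good order or some rank
   is below t; closing under the permutations of these stages makes the
   complement a union of orbits. *)
Let E t := invariant_hull (u t) (fun i => perm (p i)) (base t).

Let small_E t : small (E t).
Proof.
apply: small_invariant_hull (card_u t) _ _ => [i [/p_bij/bij_inj//]|].
apply: (smallU regT); apply: (small_bigcup inaccT (card_u t)) => i [Ui _].
  apply: (small_bigcup inaccT) => [|j [[Uj _] ij]]; last exact: p_refines.
  by apply: card_le_lt_trans (card_u t); apply: subset_card_le => j [].
exact: p_rank.
Qed.

Let sub_u s t : lt s t -> u s `<=` u t.
Proof. by move=> st i [Ui es]; split=> //; exact: tr es st. Qed.

Let E_perm t i x : u t i -> E t x <-> E t (perm (p i) x).
Proof.
by move=> ui; split=> Ex C BC invC;
  [apply: (invC i ui x).1|apply: (invC i ui x).2]; exact: Ex.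
Qed.

(* The stages that are active at x.  Any two of them are in good order at x
   (common), and they act on the points with the same active stages (v_perm), so
   that the limit can be taken separately on each class of such points. *)
Let v x := [set i | exists2 t, u t i & ~ E t x].

Let common x i j : v x i -> v x j -> exists t, [/\ u t i, u t j & ~ E t x].
Proof.
move=> [s usi nEs] [t utj nEt]; have [st|st|ts] := tot s t.
- by exists t; split=> //; exact: sub_u usi.
- by exists t; split=> //; rewrite -st.
- by exists s; split=> //; exact: sub_u utj.
Qed.

Let v_perm x i : v x i -> v (perm (p i) x) = v x.
Proof.
move=> vxi; apply/seteqP; split=> j; last first.
  by move=> /(common vxi)[t [ui uj nE]]; exists t => //; rewrite -E_perm.
move=> [t utj nEt]; have [s usi nEs] := vxi; have [st|st|ts] := tot s t.
- exists t => //; rewrite (E_perm x (sub_u st usi)) //.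
- by exists t => //; rewrite (@E_perm t i) // -st.
- by exists s; [exact: sub_u utj|].
Qed.

Let v_permV x i : v (perm (p i) x) i -> v (perm (p i) x) = v x.
Proof. by move=> [t ui nE]; apply: v_perm; exists t => //; rewrite (E_perm x ui). Qed.

Let v_refines x i j : v x i -> v x j -> ltI i j ->
  refines_at (p i) (perm (p j)) (rank (p j)) x.
Proof.
move=> vi vj ij; have [t [ui uj nE]] := common vi vj; apply: contrapT => nr.
by apply: nE => C BC _; apply: BC; left; exists i => //; exists j.
Qed.

Let v_rank t x i : ~ E t x -> v x i -> ~ lt (rank (p i) x) t.
Proof.
move=> nEt [s usi nEs] xt.
have [r [uri nEr tr']] : exists r, [/\ u r i, ~ E r x & ~ lt r t].
  have [st|st|ts] := tot s t.
  - by exists t; split=> //; [exact: sub_u usi|exact: lt_irr].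
  - by exists t; split=> //; [rewrite -st|exact: lt_irr].
  - by exists s; split=> // st; exact: lt_irr (tr ts st).
apply: nEr => C BC _; apply: BC; right; exists i => //; exact: lt_le xt tr'.
Qed.

Let minimal x i := v x i /\ forall j, v x j -> ~ lt (rank (p j) x) (rank (p i) x).

(* Past a stage of least rank, x can no longer be moved. *)
Let stable x i j : minimal x i -> v x j -> ltI i j -> perm (p j) x = perm (p i) x.
Proof.
move=> [vi mi] vj ij; have [_ ref] := v_refines vi vj ij.
have [_ [/p_bij[h _ hK] _] _] := vi.
by have [hx|[/(mi j vj)//]] := ref _ (hK (perm (p j) x)); rewrite -{2}hx hK.
Qed.

(** At each point take the image and the rank given by an active stage of least
    rank.  The limit is injective because the images of two points agree with
    the limit at every large active stage; it is onto because the preimages of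
    a point under the active stages have nonincreasing ranks as well, hence
    become constant. *)
Lemma limit_ranked_perm : exists g r : T -> T,
  [/\ bijective g, tends_to_lambda r &
      forall i, U i -> small [set x | ~ refines_at (p i) g r x]].
Proof.
have /choice[gr grP] x : exists y : T * T,
    (exists i, [/\ minimal x i, y.1 = perm (p i) x & y.2 = rank (p i) x]) \/
    (forall i, ~ v x i) /\ y = (x, x).
  have [vx|nvx] := pselect (exists i, v x i).
    have [|t [[i [vi ti]] tmin]] := @strict_well_order_min _ _
        (fun t => exists i, v x i /\ t = rank (p i) x) wf.
      by have [i vi] := vx; exists (rank (p i) x), i.
    exists (perm (p i) x, rank (p i) x); left; exists i; split=> //; split=> //.
    by move=> j vj; rewrite -ti; apply: tmin; exists j.
  by exists (x, x); right; split=> // i vi; apply: nvx; exists i.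
pose g x := (gr x).1; pose r x := (gr x).2; exists g, r; split.
- have vg x : v (g x) = v x.
    by have [[i [[vi _] gE _]]|[_ gE]] := grP x; rewrite /g gE ?v_perm.
  have U_inj z k : v z k -> injective (perm (p k)).
    by move=> [t [Uk _] _]; exact: bij_inj (p_bij Uk).
  apply: injective_surjective_bijective => [x y gxy|y].
    have vxy : v x = v y by rewrite -vg gxy vg.
    have [[i [mi gi _]]|[nvx gx]] := grP x;
      have [[j [mj gj _]]|[nvy gy]] := grP y.
    + have vxj : v x j by rewrite vxy; exact: mj.1.
      have vyi : v y i by rewrite -vxy; exact: mi.1.
      have [ij|ij|ji] := totI i j.
      * by apply: (U_inj _ _ vxj); rewrite (stable mi vxj ij) -gi -gj.
      * by apply: (U_inj _ _ vxj); rewrite -gj -ij -gi.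
      * by apply: (U_inj _ _ vyi); rewrite (stable mj vyi ji) -gi -gj.
    + by case: (nvy i); rewrite -vxy; exact: mi.1.
    + by case: (nvx j); rewrite vxy; exact: mj.1.
    + by move: gxy; rewrite /g gx gy.
  have [[i0 vi0]|nvy] := pselect (exists i, v y i); last first.
    exists y; have [[i [[vi _] _ _]]|[_ gE]] := grP y; last by rewrite /g gE.
    by case: nvy; exists i.
  have /choice[h hK] i : exists x, v y i -> perm (p i) x = y.
    have [[t [/p_bij[k _ kK] _] _]|nvi] := pselect (v y i); last by exists y.
    by exists (k y).
  have vh i : v y i -> v (h i) = v y.
    by move=> vi; rewrite -(@v_permV (h i) i) (hK i vi).
  (* h i is the preimage of y under stage i; take i with h i of least rank. *)
  have [|t [[i [vi ti]] tmin]] := @strict_well_order_min _ _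
      (fun t => exists i, v y i /\ t = rank (p i) (h i)) wf.
    by exists (rank (p i0) (h i0)), i0.
  exists (h i); have [[j [mj gj _]]|[nv _]] := grP (h i); last first.
    by case: (nv i); rewrite vh.
  have vj : v y j by rewrite -(vh i vi); exact: mj.1.
  rewrite /g gj; have [ij|<-|ji] := totI i j; last 2 first.
  + exact: hK.
  + by rewrite -(stable mj _ ji) ?vh //; exact: hK.
  have [_ ref] : refines_at (p i) (perm (p j)) (rank (p j)) (h j).
    by apply: v_refines; rewrite ?vh.
  have [|->|[_ ltj _]] := ref (h i); rewrite ?hK //.
  by case: (tmin _ (ex_intro _ j (conj vj erefl))); rewrite ti.
- move=> t; apply: sub_small (smallU regT (small_E t) (small_seg seg t)) => x /=.
  have [[i [[vi _] _ rE]]|[_ rE]] := grP x; rewrite /r rE => xt; last by right.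
  by left; apply: contrapT => nEt; exact: v_rank nEt vi xt.
- move=> i Ui; have [t et] := lt_unbounded inaccT wo seg (e i).
  apply: sub_small (small_E t) => x nref; apply: contrapT => nEt; apply: nref.
  have vi : v x i by exists t.
  have [[j [mj gE rE]]|[nv _]] := grP x; last by case: (nv i).
  rewrite /refines_at /g /r gE rE; split; first exact: mj.2.
  have [_ [Ui' _] _] := vi; have inj := bij_inj (p_bij Ui).
  have [ij|<-|ji] := totI i j; last 2 first.
  - by move=> x' /inj; left.
  - by move=> x'; rewrite -(stable mj vi ji) => /inj; left.
  - exact: (v_refines vi mj.1 ij).2.
Qed.

End Limit.
End RankedPermutations.

(** * Disagreeing with a given map *)

Section Step.
Variables (T : Type) (inaccT : inaccessible T).
Variable lt : T -> T -> Prop.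
Hypothesis wo : strict_well_order lt.
Hypothesis seg : forall x, ~ ([set: T] #<= [set y | lt y x]).

Let regT := inaccessible_regular inaccT.
Let tot := let: And3 _ _ tot := wo in tot.
Let wf := let: And3 wf _ _ := wo in wf.

(** The composition of a permutation of rank [r] with [h], given the new rank
    [r'], still refines every stage tracking [D]: see [refines_at_comp]. *)
Definition lowers_rank_at (D : tracked -> set T) (r h r' : T -> T) x :=
  h x = x /\ r' x = r x \/
  [/\ lt (r' x) (r x), lt (r' x) (r (h x)) & forall k, D k (h x) <-> D k x].

Section Swap.
Variables (I : Type) (U : set I) (e : I -> T).
Hypothesis einj : forall i j, U i -> U j -> e i = e j -> i = j.
Variables (Z : I -> tracked -> set T) (r : T -> T).
Hypothesis r_rank : tends_to_lambda lt r.

Let disjoint_pairs (v w : T * T) :=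
  [/\ v.1 <> w.1, v.1 <> w.2, v.2 <> w.1 & v.2 <> w.2].

(** At step [t] all points outside a small set are fresh and of rank above [t],
    and the fewer than lambda sets to be respected take fewer than lambda
    patterns on them, so that two points have the same pattern. *)
Lemma indistinguishable_pairs (A : set T) : ~ small A ->
  exists ab : T -> T * T, forall t,
    [/\ A (ab t).1, lt t (r (ab t).1), lt t (r (ab t).2), (ab t).1 <> (ab t).2 &
        forall i k, U i -> lt (e i) t -> Z i k (ab t).1 <-> Z i k (ab t).2] /\
    forall s, lt s t -> disjoint_pairs (ab s) (ab t).
Proof.
move=> nA; have x0 := inhabitant inaccT.
pose Q t (v : T * T) := [/\ A v.1, lt t (r v.1), lt t (r v.2), v.1 <> v.2 &
  forall i k, U i -> lt (e i) t -> Z i k v.1 <-> Z i k v.2].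
apply: (well_founded_choice (x0, x0) (Q := Q) wf) => t h _.
pose u := [set i | U i /\ lt (e i) t].
have su : card_lt u [set: T].
  apply: card_le_lt_trans (small_seg seg t).
  apply: (injection_card_le (f := e)) => [i []//|i j [Ui _] [Uj _]]; exact: einj.
pose N := (\bigcup_(s in [set s | lt s t]) [set (h s).1; (h s).2]) `|`
  [set x | ~ lt t (r x)].
have sN : small N.
  apply: (smallU regT).
    apply: (small_bigcup inaccT (small_seg seg t)) => s _.
    by apply: (smallU regT); exact: small_set1.
  have [t' tt'] := lt_unbounded inaccT wo seg t.
  apply: sub_small (r_rank t') => x /= ntx; exact/(le_lt wo ntx).
have nAN := not_small_diff inaccT nA sN.
have [A1 [sA1 nA1 Z1]] := pigeonhole_colours inaccT (Z^~ Source) su nAN.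
have [A2 [sA2 nA2 Z2]] := pigeonhole_colours inaccT (Z^~ Target) su nA1.
have [A3 [sA3 nA3 Z3]] := pigeonhole_colours inaccT (Z^~ Witness) su nA2.
have [a [b [A3a A3b ab]]] := not_small_ex2 inaccT nA3.
have A3N x : A3 x -> [/\ A x, lt t (r x) & forall s, lt s t ->
    x <> (h s).1 /\ x <> (h s).2].
  move=> /sA3/sA2/sA1[Ax nNx]; split=> //.
    by apply: contrapT => ntx; apply: nNx; right.
  by move=> s st; split=> xh; apply: nNx; left; exists s => //; [left|right].
have [Aa ra na] := A3N _ A3a; have [Ab rb nb] := A3N _ A3b.
exists (a, b); split; last first.
  move=> s st; have [na1 na2] := na s st; have [nb1 nb2] := nb s st.
  by split=> /= /esym.
split=> // i [] Ui et; [apply: Z1|apply: Z2|apply: Z3] => //.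
- exact/sA2/sA3.
- exact/sA2/sA3.
- exact/sA3.
- exact/sA3.
Qed.

(** Both points of the [t]-th pair get rank [t].  A given stage [i] is respected
    by all pairs after the one with number [e i]. *)
Lemma swap_indistinguishable_pairs (A : set T) : ~ small A ->
  exists (h r' : T -> T) (B : set T), [/\ involutive h, tends_to_lambda lt r',
    forall i, U i -> small [set x | ~ lowers_rank_at (Z i) r h r' x] &
    [/\ B `<=` A, ~ small B & B `&` h @` B = set0]].
Proof.
move=> /indistinguishable_pairs[ab abP].
pose a t := (ab t).1; pose b t := (ab t).2.
have dis s t : s <> t -> disjoint_pairs (ab s) (ab t).
  move=> nst; have [st|//|ts] := tot s t; first exact: (abP t).2.
  by have [n1 n2 n3 n4] := (abP s).2 t ts; split; apply: nesym.
have nab t : a t <> b t by have [[]] := abP t.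
have ainj s t : a s = a t -> s = t.
  by move=> st; apply: contrapT => /dis[].
have binj s t : b s = b t -> s = t.
  by move=> st; apply: contrapT => /dis[].
have nabs s t : a s <> b t.
  have [->|/dis[]//] := pselect (s = t); exact: nab.
(* hr x is the image of x together with its new rank. *)
have /choice[hr hrP] x : exists y : T * T, [/\ forall t, x = a t -> y = (b t, t),
    forall t, x = b t -> y = (a t, t) &
    (forall t, x <> a t /\ x <> b t) -> y = (x, r x)].
  have [[t ->]|na] := pselect (exists t, x = a t).
    exists (b t, t); split=> [s /ainj->//|s /nabs//|/(_ t)[]//].
  have [[t ->]|nb] := pselect (exists t, x = b t).
    exists (a t, t); split=> [s /esym/nabs//|s /binj->//|/(_ t)[_]//].
  exists (x, r x); split=> // t xt; first by case: na; exists t.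
  by case: nb; exists t.
have ha t : hr (a t) = (b t, t) by have [/(_ t erefl)] := hrP (a t).
have hb t : hr (b t) = (a t, t) by have [_ /(_ t erefl)] := hrP (b t).
have hx x : (exists t, x = a t \/ x = b t) \/ hr x = (x, r x).
  have [ex|nx] := pselect (exists t, x = a t \/ x = b t); first by left.
  right; have [_ _] := hrP x; apply.
  by move=> t; split=> xt; apply: nx; exists t; [left|right].
exists (fun x => (hr x).1), (fun x => (hr x).2), (range a); split.
- move=> x; have [[t [->|->]]|hxE] := hx x; by rewrite ?ha /= ?hb /= ?ha // !hxE.
- move=> t; apply: sub_small (smallU regT (r_rank t) (smallU regT
    (small_image a (small_seg seg t)) (small_image b (small_seg seg t)))) => x /=.
  have [[s [->|->]]|->] := hx x; rewrite ?ha ?hb /= => st; last by left.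
    by right; left; exists s.
  by right; right; exists s.
- move=> i Ui; apply: sub_small (smallU regT
    (small_image a (small_segle inaccT wo seg (e i)))
    (small_image b (small_segle inaccT wo seg (e i)))) => x /= nx.
  have [[t xt]|hxE] := hx x; last by case: nx; left; rewrite hxE.
  have [it|nit] := pselect (lt (e i) t); last first.
    by case: xt => ->; [left|right]; exists t.
  have [[_ ra rb _ /(_ i _ Ui it) Zi] _] := abP t.
  by case: nx; right; case: xt => ->; rewrite ?ha ?hb; split=> // k; rewrite Zi.
- split; first by move=> _ [t _ <-]; have [[]] := abP t.
    by apply: (not_small_injective (@not_smallT T)) => s t _ _; exact: ainj.
  rewrite -subset0 => _ [[s _ <-] [_ [t _ <-]]]; rewrite ha /= => /esym.
  exact: nabs.
Qed.

End Swap.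

(** Either the given permutation already disagrees with [f] on [B], or else it
    agrees and swapping destroys the agreement. *)
Lemma disagreeing_extension (I : Type) (U : set I) (e : I -> T)
    (Z : I -> tracked -> set T) (g r : T -> T) (A : set T) (f : T -> T) :
  (forall i j, U i -> U j -> e i = e j -> i = j) ->
  injective g -> tends_to_lambda lt r ->
  exists (h r' : T -> T) (B : set T), [/\ involutive h, tends_to_lambda lt r',
    forall i, U i -> small [set x | ~ lowers_rank_at (Z i) r h r' x], B `<=` A &
    ~ small A -> ~ small ((g \o h) @` B `+` f @` B)].
Proof.
move=> einj ginj rr.
have triv B : B `<=` A -> (~ small A -> ~ small (g @` B `+` f @` B)) ->
    exists (h r' : T -> T) (B : set T), [/\ involutive h, tends_to_lambda lt r',
    forall i, U i -> small [set x | ~ lowers_rank_at (Z i) r h r' x], B `<=` A &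
    ~ small A -> ~ small ((g \o h) @` B `+` f @` B)].
  move=> BA nB; exists id, r, B; split=> // i _.
  by apply: sub_small (small0 regT) => x; case; left.
have [sA|nA] := pselect (small A); first by apply: (triv set0) => // /(_ sA).
have [h [r' [B [hK r'r hZ [BA nB hB]]]]] := swap_indistinguishable_pairs einj Z rr nA.
have [sgf|nsgf] := pselect (small (g @` B `+` f @` B)); last exact: triv BA (fun=> nsgf).
exists h, r', B; split=> // _ sghf.
apply: (not_small_injective nB (f := g)) => [x y _ _ /ginj//|].
apply: sub_small (smallU regT sgf sghf) => _ [x Bx <-].
have [fgx|nfgx] := pselect ((f @` B) (g x)); last by left; left; split=> //; exists x.
right; right; split=> // -[y By /ginj hyx].
have : (B `&` h @` B) x by split=> //; exists y.
by rewrite hB.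
Qed.

End Step.

(** * The tower of permutations *)

Lemma refines_at_comp T (lt : T -> T -> Prop) (p : ranked_perm T)
    (g r h r' : T -> T) x : strict_well_order lt ->
  refines_at lt p g r x -> refines_at lt p g r (h x) ->
  lowers_rank_at lt (track p) r h r' x ->
  refines_at lt p (g \o h) r' x.
Proof.
move=> wo refx [rhx refhx] [[hx r'x]|[r'x r'hx Zx]].
  by rewrite /refines_at /= hx r'x.
have [wf tr _] := wo.
have r'p : lt (r' x) (rank p x) := lt_le wo r'x refx.1.
split=> [pr'|x' /refhx[->|[_ hx' Zhx]]].
- exact/(lt_irr wo)/(tr _ _ _ r'p pr').
- by right; split=> //; exact/(lt_le wo r'hx).
- right; split=> // [|k]; first exact: tr r'hx hx'.
  by rewrite Zhx.
Qed.

(** Read a subset of [T], through the pairing function, as the graph of a map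
    defined on a part of [T]. *)
Lemma decode_tasks T : T -> (exists pr : T * T -> T, injective pr) ->
  exists (dom : set T -> set T) (fn : set T -> T -> T), forall A (f : T -> T),
    exists a, dom a = A /\ forall x, A x -> fn a x = f x.
Proof.
move=> x0 [pr prinj].
pose dom (a : set T) := [set x | exists y, a (pr (x, y))].
have /choice[fn fnP] (ax : set T * T) : exists y, dom ax.1 ax.2 -> ax.1 (pr (ax.2, y)).
  have [[y ay]|na] := pselect (dom ax.1 ax.2); last by exists x0.
  by exists y.
exists dom, (fun a x => fn (a, x)) => A f; exists [set pr (x, f x) | x in A].
have domE : dom [set pr (x, f x) | x in A] = A.
  apply/seteqP; split=> x; first by move=> [y [x' Ax' /prinj[<-]]].
  by move=> Ax; exists (f x); exists x.
split=> // x Ax; have [|x' Ax' /prinj[-> ->]//] := fnP ([set pr (x, f x) | x in A], x).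
by rewrite /= domE.
Qed.

Section Tower.
Variables (T : Type) (inaccT : inaccessible T).
Variable lt : T -> T -> Prop.
Hypothesis wo : strict_well_order lt.
Hypothesis seg : forall x, ~ ([set: T] #<= [set y | lt y x]).
Variable ltW : set T -> set T -> Prop.
Hypothesis woW : strict_well_order ltW.
Hypothesis segW : forall a, [set b | ltW b a] #<= [set: T].
Variables (dom : set T -> set T) (fn : set T -> T -> T).

Let regT := inaccessible_regular inaccT.
Let totW := let: And3 _ _ tot := woW in tot.
Let wfW := let: And3 wf _ _ := woW in wf.

Definition solves_task (a : set T) (p : ranked_perm T) :=
  [/\ bijective (perm p), tends_to_lambda lt (rank p), track p Source = a,
      track p Target = perm p @^-1` a &
      track p Witness `<=` dom a /\ (~ small (dom a) ->
        ~ small (perm p @` track p Witness `+` fn a @` track p Witness))].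

Lemma tower_exists : exists p : set T -> ranked_perm T, forall a,
  solves_task a (p a) /\ forall b, ltW b a -> refines lt (p b) (p a).
Proof.
have x0 := inhabitant inaccT.
apply: (well_founded_choice (RankedPerm id id (fun=> set0)) wfW) => a h hP.
have [e [_ einj]] := card_le_injection x0 (segW a).
have [g [r [gbij rr gr]]] : exists g r : T -> T,
    [/\ bijective g, tends_to_lambda lt r & forall b, ltW b a ->
        small [set x | ~ refines_at lt (h b) g r x]].
  apply: (limit_ranked_perm inaccT wo seg totW einj) => [b /hP[[]]//|b /hP[[]]//|].
  by move=> b c _ /hP[_]; exact.
have [s [r' [B [sK r'r sZ BA nB]]]] := disagreeing_extension inaccT wo seg
  (fun b => track (h b)) (dom a) (fn a) einj (bij_inj gbij) rr.
exists (RankedPerm (g \o s) r' (fun k => match k with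
  | Source => a | Target => (g \o s) @^-1` a | Witness => B end)); split.
  by split=> //; exact: bij_comp gbij (inv_bij sK).
move=> b ba; apply: sub_small (smallU regT (sZ b ba) (smallU regT (gr b ba)
  (small_preimage (inv_inj sK) (gr b ba)))) => x /= nref.
apply: contrapT => /not_orP[/contrapT sx /not_orP[/contrapT rx /contrapT rsx]].
by apply: nref; exact: refines_at_comp wo rx rsx sx.
Qed.

End Tower.

Lemma refines_image T (inaccT : inaccessible T) (lt : T -> T -> Prop)
    (p q : ranked_perm T) k :
  bijective (perm p) -> bijective (perm q) -> refines lt p q ->
  small (perm q @` track p k `+` perm p @` track p k).
Proof.
move=> [gp _ gpK] [gq _ gqK] pq.
apply: sub_small (small_image (perm q) pq) => y [[[x Zx <-] npx]|[[x' Zx' <-] nqx]].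
  exists x => // -[_ /(_ (gp (perm q x)) (gpK _)) ref]; apply: npx.
  exists (gp (perm q x)); last exact: gpK.
  by case: ref => [->//|[_ _ ->]].
exists (gq (perm p x')); last exact: gqK.
move=> [_ /(_ x')]; rewrite gqK => /(_ erefl) ref; apply: nqx.
exists (gq (perm p x')); last exact: gqK.
by case: ref => [<-//|[_ _ <-]].
Qed.

(** * The limit automorphism *)

Section Automorphism.
Variables (T : Type) (inaccT : inaccessible T).
Variable lt : T -> T -> Prop.
Variable ltW : set T -> set T -> Prop.
Hypothesis woW : strict_well_order ltW.
Variables (dom : set T -> set T) (fn : set T -> T -> T).
Hypothesis tasks : forall A (f : T -> T),
  exists a, dom a = A /\ forall x, A x -> fn a x = f x.
Variable p : set T -> ranked_perm T.
Hypothesis p_task : forall a, solves_task lt dom fn a (p a).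
Hypothesis p_refines : forall a b, ltW b a -> refines lt (p b) (p a).

Let regT := inaccessible_regular inaccT.
Let trW := let: And3 _ tr _ := woW in tr.
Let totW := let: And3 _ _ tot := woW in tot.

Notation cl := (class_of regT).
Notation g a := (perm (p a)).

Let g_bij a : bijective (g a). Proof. by have [] := p_task a. Qed.
Let g_inj a : injective (g a). Proof. exact: bij_inj (g_bij a). Qed.
Let g_surj a y : exists x, g a x = y.
Proof. by have [h _ hK] := g_bij a; exists (h y). Qed.

Let eventually (P : set T -> Prop) := exists a, forall c, ~ ltW c a -> P c.

Let eventuallyI P Q : eventually P -> eventually Q ->
  eventually (fun c => P c /\ Q c).
Proof.
move=> [a Pa] [b Qb]; have [ab|ab|ba] := totW a b.
- exists b => c cb; split; last exact: Qb.
  by apply: Pa => ca; apply: cb; exact: trW ca ab.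
- by exists a => c ca; split; [exact: Pa|apply: Qb; rewrite -ab].
- exists a => c ca; split; first exact: Pa.
  by apply: Qb => cb; apply: ca; exact: trW cb ba.
Qed.

Let eventually_ex P : eventually P -> exists c, P c.
Proof. by move=> [a Pa]; exists a; apply: Pa; exact: lt_irr woW _. Qed.

Let track_stable a k : eventually (fun c =>
  cl (g c @` track (p a) k) = cl (g a @` track (p a) k)).
Proof.
exists a => c ca; have [ac|<-//|//] := totW a c; apply/class_ofP.
exact: (refines_image inaccT k (g_bij a) (g_bij c) (p_refines ac)).
Qed.

Let source a : track (p a) Source = a. Proof. by have [] := p_task a. Qed.

Let image_class c A B : cl A = cl B -> cl (g c @` A) = cl (g c @` B).
Proof.
move=> /class_ofP AB; apply/class_ofP; apply: sub_small (small_image (g c) AB).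
move=> _ [[[x Ax <-] nB]|[[x Bx <-] nA]]; exists x => //.
  by left; split=> // Bx; apply: nB; exists x.
by right; split=> // Ax; apply: nA; exists x.
Qed.

Let image_classV c A B : cl (g c @` A) = cl (g c @` B) -> cl A = cl B.
Proof.
move=> /class_ofP AB; apply/class_ofP.
apply: sub_small (small_preimage (@g_inj c) AB) => x [[Ax nBx]|[Bx nAx]].
  by left; split; [exists x|move=> [y By /g_inj yx]; apply: nBx; rewrite -yx].
by right; split; [exists x|move=> [y Ay /g_inj yx]; apply: nAx; rewrite -yx].
Qed.

(** The set [repr X] is one of the sets tracked at the stage that it indexes, so
    that this stage already decides its image. *)
Definition tower_limit (X : Pmod regT) : Pmod regT := cl (g (repr X) @` repr X).

Let tower_limitE A : eventually (fun c => tower_limit (cl A) = cl (g c @` A)).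
Proof.
have [a Pa] := track_stable (repr (cl A)) Source.
exists a => c /Pa; rewrite source /tower_limit => <-; apply: image_class.
exact: reprK.
Qed.

Lemma tower_limit_automorphism : boolean_automorphism tower_limit.
Proof.
have IE A B : (cl A `&` cl B)%O = cl (A `&` B) := esym (class_ofI regT A B).
have UE A B : (cl A `|` cl B)%O = cl (A `|` B) := esym (class_ofU regT A B).
have CE A : (~` cl A)%O = cl (~` A) := esym (class_ofC regT A).
split.
- apply: injective_surjective_bijective.
    elim/class_ofW=> A; elim/class_ofW=> B.
    have [c [-> ->]] := eventually_ex (eventuallyI (tower_limitE A) (tower_limitE B)).
    exact: image_classV.
  elim/class_ofW=> a; exists (cl (g a @^-1` a)).
  have [_ _ _ target _] := p_task a.
  have [c [-> +]] := eventually_ex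
    (eventuallyI (tower_limitE (g a @^-1` a)) (track_stable a Target)).
  rewrite target => ->; congr cl; apply/seteqP; split=> [_ [x gx <-]//|y ay].
  by have [x xy] := g_surj a y; exists x => //=; rewrite xy.
- split; elim/class_ofW=> A; elim/class_ofW=> B.
    have [c [-> [-> EI]]] := eventually_ex (eventuallyI (tower_limitE A)
      (eventuallyI (tower_limitE B) (tower_limitE (A `&` B)))).
    rewrite !IE EI; congr cl; apply/seteqP; split=> [_ [x [Ax Bx] <-]|z].
      by split; exists x.
    by move=> [[x Ax <-] [y By /g_inj yx]]; exists x => //; split=> //; rewrite -yx.
  have [c [-> [-> EU]]] := eventually_ex (eventuallyI (tower_limitE A)
    (eventuallyI (tower_limitE B) (tower_limitE (A `|` B)))).
  by rewrite !UE EU image_setU.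
- elim/class_ofW=> A.
  have [c [-> EC]] := eventually_ex (eventuallyI (tower_limitE A)
    (tower_limitE (~` A))).
  rewrite !CE EC; congr cl; apply/seteqP; split=> [_ [x nAx <-] [y Ay /g_inj yx]|y ny].
    by apply: nAx; rewrite -yx.
  have [x xy] := g_surj c y; exists x => // Ax; apply: ny; by exists x.
- have [c E0] := eventually_ex (tower_limitE set0).
  by rewrite [LHS]E0 image_set0.
- have [c ET] := eventually_ex (tower_limitE setT).
  rewrite [LHS]ET; congr cl; apply/seteqP; split=> // y _.
  by have [x xy] := g_surj c y; exists x.
Qed.

Lemma tower_limit_nowhere_trivial : nowhere_trivial tower_limit.
Proof.
move=> A AT [f [_ fA]]; have [a [domA fnA]] := tasks A f.
have nsA : ~ small A by move=> [_]; apply; rewrite card_eq_le in AT; case/andP: AT.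
have [_ _ _ _ []] := p_task a; rewrite domA => BA /(_ nsA); apply.
have [c [EB]] := eventually_ex
  (eventuallyI (tower_limitE (track (p a) Witness)) (track_stable a Witness)).
rewrite -EB fA // => EfB; apply/(class_ofP regT); rewrite -EfB; congr cl.
by apply: eq_imagel => x /BA /fnA.
Qed.

End Automorphism.

Theorem theorem5p3 (T : Type) (inaccT : inaccessible T)
    (succT : succ_card T (set T)) :
  exists pi : Pmod (inaccessible_regular inaccT) ->
              Pmod (inaccessible_regular inaccT),
    boolean_automorphism pi /\ nowhere_trivial pi.
Proof.
have [lt [wo seg]] := minimal_well_order T.
have [ltW [woW segW]] := minimal_well_order (set T).
have segWT a : [set b | ltW b a] #<= [set: T].
  have [//|TS] := card_le_total [set b | ltW b a] [set: T].
  apply: contrapT => nST; apply: (segW a).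
  have /succT.2 : card_lt [set: T] [set: [set b | ltW b a]].
    by rewrite /card_lt (card_le_eqr (card_setT _)) (card_le_eql (card_setT _)).
  by rewrite (card_le_eqr (card_setT _)).
have [dom [fn tasks]] := decode_tasks (inhabitant inaccT) (pairing inaccT wo seg).
have [p pP] := tower_exists inaccT wo seg woW segWT dom fn.
have p_task a := (pP a).1; have p_refines a := (pP a).2.
exists (@tower_limit T inaccT p); split.
  exact: (tower_limit_automorphism inaccT woW p_task p_refines).
exact: (tower_limit_nowhere_trivial (inaccT:=inaccT) woW tasks p_task p_refines).
Qed.
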